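(* Let $0\le R_1<R_2\le+\infty$, $\Omega=\{x\in\mathbb{R}^2:\ R_1<|x|<R_2\}$, let $a$ be a positive differentiable function on $(R_1,R_2)$, let $\varepsilon\in\{1,-1\}$ and $q>0$, $q\ne1$. If the equation $$\Delta u=\varepsilon\, a^2(|x|)\,u|u|^{q-1}$$ admits a non-radial pseudo-radial solution in $\Omega$, then the function $r\mapsto a(r)$ has on $(R_1,R_2)$ one of the three following forms: (1) $a(r)=r^{-1}\left[Mr^\alpha+Nr^{-\alpha}\right]^{\frac{1-q}{2}}$, where $\alpha>0$ and $M,N\in\mathbb{R}$ are such that $Mr^\alpha+Nr^{-\alpha}>0$ on $(R_1,R_2)$; (2) $a(r)=r^{-1}\left[M+N\ln r\right]^{\frac{1-q}{2}}$, where $M,N\in\mathbb{R}$ are such that $M+N\ln r>0$ on $(R_1,R_2)$; (3) $a(r)=r^{-1}\left[M\cos(\alpha\ln r)+N\sin(\alpha\ln r)\right]^{\frac{1-q}{2}}$, where $\alpha>0$ and $M,N\in\mathbb{R}$.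
   Context: $\Delta$ is the Euclidean Laplacian on $\mathbb{R}^2$ and $(r,\theta)$ are polar coordinates, $r=|x|$. Solutions are real-valued classical solutions. A solution $u$ is pseudo-radial if $u(r,\theta)=h(r)w(\theta)$ for some function $h$ on $(R_1,R_2)$ and some $2\pi$-periodic function $w$; it is radial if it does not depend on $\theta$, and non-radial otherwise. *)

(* Defs.v *)
(* Stdlib reals with Coquelicot.  The plane is R^2 in Cartesian coordinates, and
   functions on it are curried functions R -> R -> R, as in Coquelicot.Derive_2d. *)
From Stdlib Require Import Reals.
From Coquelicot Require Import Coquelicot.
Open Scope R_scope.

Definition in_interval (R1 : R) (R2 : Rbar) (r : R) : Prop :=
  R1 < r /\ Rbar_lt r R2.

Definition radius (x y : R) : R := sqrt (x ^ 2 + y ^ 2).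

Definition annulus (R1 : R) (R2 : Rbar) (x y : R) : Prop :=
  in_interval R1 R2 (radius x y).

Definition laplacian (u : R -> R -> R) (x y : R) : R :=
  partial_derive 2 0 u x y + partial_derive 0 2 u x y.

(* t |t|^(q-1).  At t = 0, Rpower (Rabs t) (q - 1) is a junk value, but the
   factor t makes the product 0, which is the intended value since q > 0. *)
Definition signed_power (q t : R) : R := t * Rpower (Rabs t) (q - 1).

(* The annulus is open, so ex_diff_n u 2 at each of its points says that u is
   of class C^2 there. *)
Definition classical_solution (R1 : R) (R2 : Rbar) (a : R -> R) (eps q : R)
    (u : R -> R -> R) : Prop :=
  forall x y : R, annulus R1 R2 x y ->
    ex_diff_n u 2 x y /\
    laplacian u x y = eps * (a (radius x y)) ^ 2 * signed_power q (u x y).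

Definition polar (u : R -> R -> R) (r theta : R) : R :=
  u (r * cos theta) (r * sin theta).

(* Only the values of h on (R1, R2) matter. *)
Definition pseudo_radial (R1 : R) (R2 : Rbar) (u : R -> R -> R) : Prop :=
  exists h w : R -> R,
    (forall theta : R, w (theta + 2 * PI) = w theta) /\
    (forall r theta : R, in_interval R1 R2 r -> polar u r theta = h r * w theta).

Definition radial (R1 : R) (R2 : Rbar) (u : R -> R -> R) : Prop :=
  forall r theta1 theta2 : R, in_interval R1 R2 r ->
    polar u r theta1 = polar u r theta2.

(* a(r) = r^(-1) [g(r)]^((1-q)/2) on (R1, R2).  A real power with arbitrary
   exponent requires a positive base, whereas Rpower is total (it is 1 on
   nonpositive bases), so that the positivity of g has to be explicit. *)
Definition has_form (R1 : R) (R2 : Rbar) (q : R) (a g : R -> R) : Prop :=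
  (forall r : R, in_interval R1 R2 r -> 0 < g r) /\
  (forall r : R, in_interval R1 R2 r -> a r = / r * Rpower (g r) ((1 - q) / 2)).

(* Main.v *)
(** Writing u = h(r) w(theta), the polar form of the Laplacian turns the equation
    into A(r) w + h(r) w'' = C(r) phi(w), where A = r^2 h'' + r h',
    phi(t) = t |t|^(q-1) and C = eps r^2 a^2 phi(h).  At a radius r0 with
    h(r0) <> 0 this expresses w'' through w and phi(w); since w is continuous and
    not constant and q <> 1, w and phi(w) are linearly independent, so A and C are
    both constant multiples of h on the whole interval.  The first relation is an
    Euler equation, whose solutions are the three families of the theorem.  The
    second says that, wherever h <> 0, |h| is proportional to
    G = (r a)^(2/(1-q)).  Hence the continuous function h/G takes at most three
    values, so it is constant: h has no zeros and G is a multiple of h. *)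

Require Import Defs.
From Stdlib Require Import Reals Ranalysis5 Classical Lra.
From Coquelicot Require Import Coquelicot.
Open Scope R_scope.

(** * Partial derivatives; the interval and the annulus as open sets *)

Definition dx (f : R -> R -> R) (x y : R) : R := Derive (fun z => f z y) x.
Definition dy (f : R -> R -> R) (x y : R) : R := Derive (fun z => f x z) y.

Lemma in_interval_locally R1 R2 r :
  in_interval R1 R2 r -> locally r (in_interval R1 R2).
Proof.
  intros [H1 H2]. apply filter_and.
  - exact (open_gt R1 r H1).
  - exact (open_Rbar_lt R2 r H2).
Qed.

Lemma in_interval_between R1 R2 r s t :
  in_interval R1 R2 r -> in_interval R1 R2 s -> r <= t <= s ->
  in_interval R1 R2 t.
Proof.
  intros [Hr _] [_ Hs] [Hrt Hts]; split; [lra |].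
  exact (Rbar_le_lt_trans t s R2 Hts Hs).
Qed.

Lemma continuity_2d_pt_radius x y : continuity_2d_pt radius x y.
Proof.
  apply (continuity_1d_2d_pt_comp sqrt (fun u v => u ^ 2 + v ^ 2)).
  - apply continuity_pt_sqrt. nra.
  - apply continuity_2d_pt_plus; simpl;
      repeat apply continuity_2d_pt_mult;
      auto using continuity_2d_pt_id1, continuity_2d_pt_id2, continuity_2d_pt_const.
Qed.

(** The annulus is the preimage of an open interval under the continuous [radius]. This turns
    regularity at every point into regularity near every point, as the chain rule requires. *)
Lemma annulus_locally R1 R2 x y :
  annulus R1 R2 x y -> locally_2d (annulus R1 R2) x y.
Proof.
  intros H. destruct (in_interval_locally _ _ _ H) as [e He].
  destruct (continuity_2d_pt_radius x y e) as [d Hd].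
  exists d. intros u v Hu Hv. apply He. exact (Hd u v Hu Hv).
Qed.

Lemma radius_polar r t : 0 <= r -> radius (r * cos t) (r * sin t) = r.
Proof.
  intros Hr. unfold radius.
  replace ((r * cos t) ^ 2 + (r * sin t) ^ 2) with (r ^ 2).
  - now apply sqrt_pow2.
  - generalize (sin2_cos2 t); unfold Rsqr; intros H.
    transitivity (r ^ 2 * (sin t * sin t + cos t * cos t)); [rewrite H |]; ring.
Qed.

(** * Derivatives in polar coordinates and the polar Laplacian *)

(** Total differentiability comes first: [dx f] is a derivative near the point and continuous at it,
    and [dy f] is one at the point. *)
Lemma is_derive_comp_2d f X Y t dX dY :
  locally_2d (ex_diff_n f 1) (X t) (Y t) ->
  is_derive X t dX -> is_derive Y t dY ->
  is_derive (fun s => f (X s) (Y s)) t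
    (dx f (X t) (Y t) * dX + dy f (X t) (Y t) * dY).
Proof.
  intros Hf HX HY.
  apply is_derive_Reals, derivable_pt_lim_comp_2d; try now apply is_derive_Reals.
  apply filterdiff_differentiable_pt_lim.
  apply (is_derive_filterdiff f (X t) (Y t) (dx f)).
  - apply locally_2d_locally in Hf. revert Hf. apply filter_imp.
    intros [x y] (_ & Hx & _). now apply Derive_correct.
  - apply locally_2d_singleton in Hf. destruct Hf as (_ & _ & Hy & _).
    now apply Derive_correct.
  - apply locally_2d_singleton in Hf. destruct Hf as (_ & _ & _ & [Hc _] & _).
    now apply continuity_2d_pt_filterlim.
Qed.

(** Written with Cartesian partials, so that second-order formulas follow from the first-order
    lemmas applied to [dx u] and [dy u], and the polar Laplacian reduces to algebra. *)
Definition polar_r (u : R -> R -> R) (r t : R) : R :=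
  polar (dx u) r t * cos t + polar (dy u) r t * sin t.

Definition polar_rr (u : R -> R -> R) (r t : R) : R :=
  polar_r (dx u) r t * cos t + polar_r (dy u) r t * sin t.

Definition polar_t (u : R -> R -> R) (r t : R) : R :=
  r * (polar (dy u) r t * cos t - polar (dx u) r t * sin t).

(** The last term comes from differentiating [cos t] and [sin t] in [polar_t]. *)
Definition polar_tt (u : R -> R -> R) (r t : R) : R :=
  r * (polar_t (dy u) r t * cos t - polar_t (dx u) r t * sin t)
  - r * polar_r u r t.

Lemma is_derive_polar_r u r t :
  locally_2d (ex_diff_n u 1) (r * cos t) (r * sin t) ->
  is_derive (fun s => polar u s t) r (polar_r u r t).
Proof.
  intros H.
  apply (is_derive_comp_2d u (fun s => s * cos t) (fun s => s * sin t)); auto;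
    auto_derive; auto; ring.
Qed.

Lemma is_derive_polar_t u r t :
  locally_2d (ex_diff_n u 1) (r * cos t) (r * sin t) ->
  is_derive (fun s => polar u r s) t (polar_t u r t).
Proof.
  intros H.
  replace (polar_t u r t) with
    (dx u (r * cos t) (r * sin t) * (- r * sin t)
     + dy u (r * cos t) (r * sin t) * (r * cos t))
    by (unfold polar_t, polar; ring).
  apply (is_derive_comp_2d u (fun s => r * cos s) (fun s => r * sin s)); auto;
    auto_derive; auto; ring.
Qed.

Lemma ex_diff_n_2_dx_dy u x y :
  locally_2d (ex_diff_n u 2) x y ->
  locally_2d (ex_diff_n u 1) x y /\ locally_2d (ex_diff_n (dx u) 1) x y /\
  locally_2d (ex_diff_n (dy u) 1) x y.
Proof.
  intros [d H]. repeat split; exists d; intros p q Hp Hq;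
    destruct (H p q Hp Hq) as (H0 & H1 & H2 & H3 & H4); auto.
  repeat split; auto; [apply H3 | apply H4].
Qed.

Lemma is_derive_polar_rr u r t :
  locally_2d (ex_diff_n u 2) (r * cos t) (r * sin t) ->
  is_derive (fun s => polar_r u s t) r (polar_rr u r t).
Proof.
  intros H. apply ex_diff_n_2_dx_dy in H. destruct H as (_ & Hx & Hy).
  apply is_derive_polar_r in Hx. apply is_derive_polar_r in Hy.
  unfold polar_r at 1. auto_derive.
  - repeat split; eexists; eauto.
rewrite (is_derive_unique (fun s : R => polar (dx u) s t) _ _ Hx).
    rewrite (is_derive_unique (fun s : R => polar (dy u) s t) _ _ Hy).
    unfold polar_rr. ring.
Qed.

Lemma is_derive_polar_tt u r t :
  locally_2d (ex_diff_n u 2) (r * cos t) (r * sin t) ->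
  is_derive (fun s => polar_t u r s) t (polar_tt u r t).
Proof.
  intros H. apply ex_diff_n_2_dx_dy in H. destruct H as (_ & Hx & Hy).
  apply is_derive_polar_t in Hx. apply is_derive_polar_t in Hy.
  unfold polar_t at 1. auto_derive.
  - repeat split; eexists; eauto.
  - rewrite (is_derive_unique (fun s : R => polar (dx u) r s) _ _ Hx).
    rewrite (is_derive_unique (fun s : R => polar (dy u) r s) _ _ Hy).
    unfold polar_tt, polar_r. ring.
Qed.

(** The mixed partials cancel, [dx (dy u)] and [dy (dx u)] each separately; the pure ones combine by
    sin^2 + cos^2 = 1. *)
Lemma laplacian_polar u r t :
  r ^ 2 * polar_rr u r t + r * polar_r u r t + polar_tt u r t
  = r ^ 2 * polar (laplacian u) r t.
Proof.
  generalize (sin2_cos2 t); unfold Rsqr; intros H.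
  change (polar (laplacian u) r t)
    with (polar (dx (dx u)) r t + polar (dy (dy u)) r t).
  unfold polar_rr, polar_tt, polar_t, polar_r.
  transitivity (r ^ 2 * ((polar (dx (dx u)) r t + polar (dy (dy u)) r t)
                 * (sin t * sin t + cos t * cos t))); [| rewrite H]; ring.
Qed.

(** * The nonlinearity and its linear independence from the identity *)

Lemma signed_power_mult q x y :
  signed_power q (x * y) = signed_power q x * signed_power q y.
Proof.
  unfold signed_power.
  destruct (Req_dec x 0) as [-> | Hx]; [ring |].
  destruct (Req_dec y 0) as [-> | Hy]; [ring |].
  rewrite Rabs_mult, <- Rpower_mult_distr by now apply Rabs_pos_lt.
  ring.
Qed.

Lemma Rpower_inj_l x y c : 0 < x -> 0 < y -> c <> 0 -> Rpower x c = Rpower y c -> x = y.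
Proof.
  intros Hx Hy Hc H. apply ln_inv; auto.
  apply (f_equal ln) in H. rewrite !ln_Rpower in H.
  now apply Rmult_eq_reg_l in H.
Qed.

(** Supplies two points at which |w|^(q-1) differs when q <> 1; the intermediate value theorem
    provides the second value. *)
Lemma continuous_two_abs_values (w : R -> R) t1 t2 :
  continuity w -> w t1 < w t2 ->
  exists s t, w s <> 0 /\ w t <> 0 /\ Rabs (w s) <> Rabs (w t).
Proof.
  intros Hw H12.
  assert (Hmid : forall y, w t1 < y < w t2 -> exists s, w s = y).
  { intros y Hy. destruct (IVT_gen w t1 t2 y Hw) as [s [_ Hs]]; eauto.
    rewrite Rmin_left, Rmax_right; lra. }
  destruct (Rlt_le_dec 0 (w t2)) as [Hp | Hn].
  (* This midpoint exceeds both [w t1] and 0 and stays below [w t2]. *)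
  - destruct (Hmid ((Rmax (w t1) 0 + w t2) / 2)) as [s Hs].
    { generalize (Rmax_l (w t1) 0). unfold Rmax; destruct Rle_dec; lra. }
    exists s, t2. generalize (Rmax_r (w t1) 0). intros Hm.
    rewrite (Rabs_pos_eq (w t2)), Rabs_pos_eq by lra.
    assert (Rmax (w t1) 0 < w t2) by (apply Rmax_lub_lt; lra).
    repeat split; lra.
  (* Here [w t1] and the midpoint are distinct negative numbers. *)
  - destruct (Hmid ((w t1 + w t2) / 2)) as [s Hs]; [lra |].
    exists s, t1. rewrite !Rabs_left by lra. repeat split; lra.
Qed.

(** Dividing by [w t] where it is nonzero gives P = Q |w|^(q-1). Two different values of |w| force Q
    = 0, since a power with nonzero exponent is injective. *)
Lemma signed_power_independent q (w : R -> R) t1 t2 P Q :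
  q <> 1 -> continuity w -> w t1 <> w t2 ->
  (forall t, P * w t = Q * signed_power q (w t)) -> P = 0 /\ Q = 0.
Proof.
  intros Hq Hw H12 H.
  assert (H' : forall t, w t <> 0 -> P = Q * Rpower (Rabs (w t)) (q - 1)).
  { intros t Ht. specialize (H t). unfold signed_power in H.
    apply (Rmult_eq_reg_r (w t)); auto. rewrite H. ring. }
  assert (Hst : exists s t, w s <> 0 /\ w t <> 0 /\ Rabs (w s) <> Rabs (w t)).
  { destruct (Rtotal_order (w t1) (w t2)) as [Hlt | [He | Hlt]]; [| tauto |];
      eapply continuous_two_abs_values; eauto. }
  destruct Hst as (s & t & Hs & Ht & Hst).
  assert (HQ : Q = 0).
  { destruct (Req_dec Q 0) as [HQ | HQ]; auto. exfalso. apply Hst.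
    apply (Rpower_inj_l _ _ (q - 1)); try (now apply Rabs_pos_lt); [lra |].
    apply (Rmult_eq_reg_l Q); auto. now rewrite <- !H'. }
  split; auto. rewrite (H' s Hs), HQ. ring.
Qed.

(** * Constancy on an interval and the Euler equation *)

Lemma discrete_valued_constant R1 R2 (F : R -> R) r s :
  (forall t, in_interval R1 R2 t -> continuity_pt F t) ->
  (forall t, in_interval R1 R2 t -> F t = 0 \/ F t = 1 \/ F t = -1) ->
  in_interval R1 R2 r -> in_interval R1 R2 s -> F r = F s.
Proof.
  intros Hc HF.
  assert (Hlt : forall r s, r < s -> in_interval R1 R2 r -> in_interval R1 R2 s ->
                  F r = F s).
  { clear r s. intros r s Hrs Hr Hs.
    assert (Hb : forall t, r <= t <= s -> in_interval R1 R2 t)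
      by (intros t; now apply in_interval_between).
    (* The sign [e] treats a rise and a fall at once. Either is a jump by at least 1, so the level
       1/2 past the start would be attained, but it is not an admissible value. *)
    assert (Hiv : forall e, e = 1 \/ e = -1 -> ~ e * F r < e * F s).
    { intros e He Hlt.
      destruct (IVT_interv (fun t => e * F t - (e * F r + 1 / 2)) r s) as [z [Hz Hz0]];
        auto.
      - intros t Ht. apply continuity_pt_minus; [apply continuity_pt_scal; auto |].
        now apply continuity_pt_const.
      - lra.
      - generalize (HF r Hr) (HF s Hs). intros. 
        destruct He as [-> | ->]; lra.
      - generalize (HF r Hr) (HF z (Hb z Hz)). intros.
        destruct He as [-> | ->]; lra. }
    generalize (Hiv 1 (or_introl eq_refl)) (Hiv (-1) (or_intror eq_refl)). lra. }
  intros Hr Hs. destruct (Rtotal_order r s) as [H | [-> | H]]; auto.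
  symmetry; auto.
Qed.

Lemma zero_derive_constant R1 R2 (f : R -> R) r s :
  (forall t, in_interval R1 R2 t -> is_derive f t 0) ->
  in_interval R1 R2 r -> in_interval R1 R2 s -> f r = f s.
Proof.
  intros Hf Hr Hs.
  destruct (Rtotal_order r s) as [H | [-> | H]]; auto; [| symmetry];
    apply (eq_is_derive f); auto; intros t Ht; apply Hf.
  - now apply (in_interval_between R1 R2 r s).
  - now apply (in_interval_between R1 R2 s r).
Qed.

(* The substitution t = ln r turns the equation into H'' = l H; each case below
   exhibits two first integrals, from which h is recovered algebraically. *)
Lemma euler_equation R1 R2 (h h1 h2 : R -> R) l r0 :
  0 <= R1 -> in_interval R1 R2 r0 ->
  (forall r, in_interval R1 R2 r -> is_derive h r (h1 r)) ->
  (forall r, in_interval R1 R2 r -> is_derive h1 r (h2 r)) ->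
  (forall r, in_interval R1 R2 r -> r ^ 2 * h2 r + r * h1 r = l * h r) ->
  (exists alpha M N, 0 < alpha /\ forall r, in_interval R1 R2 r ->
     h r = M * Rpower r alpha + N * Rpower r (- alpha)) \/
  (exists M N, forall r, in_interval R1 R2 r -> h r = M + N * ln r) \/
  (exists alpha M N, 0 < alpha /\ forall r, in_interval R1 R2 r ->
     h r = M * cos (alpha * ln r) + N * sin (alpha * ln r)).
Proof.
  intros HR1 Hr0 Hh Hh1 Heq.
  assert (Hpos : forall r, in_interval R1 R2 r -> 0 < r)
    by (intros r [Hr _]; lra).
  assert (Hh2 : forall r, in_interval R1 R2 r -> h2 r = (l * h r - r * h1 r) / r ^ 2).
  { intros r Hr. rewrite <- Heq by auto. field. specialize (Hpos r Hr). lra. }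
  assert (Hconst : forall f, (forall r, in_interval R1 R2 r -> is_derive f r 0) ->
            forall r, in_interval R1 R2 r -> f r = f r0)
    by (intros; eapply zero_derive_constant; eauto).
  assert (Hex : forall r, in_interval R1 R2 r ->
            ex_derive (fun x : R => h x) r /\ ex_derive (fun x : R => h1 x) r)
    by (intros r Hr; split; eexists; eauto).
  assert (HD : forall r, in_interval R1 R2 r ->
            Derive (fun x : R => h x) r = h1 r /\ Derive (fun x : R => h1 x) r = h2 r)
    by (intros r Hr; split; apply is_derive_unique; auto).
  destruct (Rtotal_order l 0) as [Hl | [Hl | Hl]].
  - right; right. set (k := sqrt (- l)).
    assert (Hk : 0 < k) by (apply sqrt_lt_R0; lra).
    assert (Hkl : l = - (k * k)) by (unfold k; rewrite sqrt_sqrt; lra).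
    (* These solve h = P cos + Q sin and r h' / k = - P sin + Q cos, at the angle k ln r. *)
    set (P := fun r => h r * cos (k * ln r) - r * h1 r / k * sin (k * ln r)).
    set (Q := fun r => h r * sin (k * ln r) + r * h1 r / k * cos (k * ln r)).
    exists k, (P r0), (Q r0). split; auto. intros r Hr.
    rewrite <- (Hconst P) with (r := r), <- (Hconst Q) with (r := r); auto.
    + unfold P, Q. generalize (sin2_cos2 (k * ln r)). unfold Rsqr. intros H.
      transitivity (h r * (sin (k * ln r) * sin (k * ln r)
                           + cos (k * ln r) * cos (k * ln r))); [rewrite H |]; ring.
    + clear r Hr. intros r Hr. specialize (Hpos r Hr). unfold Q.
      auto_derive; [destruct (Hex r Hr); tauto |].
      destruct (HD r Hr) as [-> ->]. rewrite Hh2 by auto. rewrite Hkl. field. lra.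
    + clear r Hr. intros r Hr. specialize (Hpos r Hr). unfold P.
      auto_derive; [destruct (Hex r Hr); tauto |].
      destruct (HD r Hr) as [-> ->]. rewrite Hh2 by auto. rewrite Hkl. field. lra.
  - right; left.
    (* As a function of ln r, [h] is affine with slope [Q] and intercept [P]. *)
    set (P := fun r => h r - r * h1 r * ln r).
    set (Q := fun r => r * h1 r).
    exists (P r0), (Q r0). intros r Hr.
    rewrite <- (Hconst P) with (r := r), <- (Hconst Q) with (r := r); auto.
    + unfold P, Q. ring.
    + clear r Hr. intros r Hr. specialize (Hpos r Hr). unfold Q.
      auto_derive; [destruct (Hex r Hr); tauto |].
      destruct (HD r Hr) as [_ ->]. rewrite Hh2 by auto. rewrite Hl. field. lra.
    + clear r Hr. intros r Hr. specialize (Hpos r Hr). unfold P.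
      auto_derive; [destruct (Hex r Hr); tauto |].
      destruct (HD r Hr) as [-> ->]. rewrite Hh2 by auto. rewrite Hl. field. lra.
  - left. set (k := sqrt l).
    assert (Hk : 0 < k) by (apply sqrt_lt_R0; lra).
    assert (Hkl : l = k * k) by (unfold k; rewrite sqrt_sqrt; lra).
    (* The operator h -> r h' / k fixes r^k and negates r^(-k), so the half sum and half difference
       isolate the two coefficients. *)
    set (P := fun r => (h r + r * h1 r / k) / 2 * exp (- k * ln r)).
    set (Q := fun r => (h r - r * h1 r / k) / 2 * exp (k * ln r)).
    exists k, (P r0), (Q r0). split; auto. intros r Hr.
    rewrite <- (Hconst P) with (r := r), <- (Hconst Q) with (r := r); auto.
    + unfold P, Q, Rpower.
      replace (- k * ln r) with (- (k * ln r)) by ring. rewrite exp_Ropp.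
      field. split; [apply Rgt_not_eq, exp_pos | lra].
    + clear r Hr. intros r Hr. specialize (Hpos r Hr). unfold Q.
      auto_derive; [destruct (Hex r Hr); tauto |].
      destruct (HD r Hr) as [-> ->]. rewrite Hh2 by auto. rewrite Hkl. field. lra.
    + clear r Hr. intros r Hr. specialize (Hpos r Hr). unfold P.
      auto_derive; [destruct (Hex r Hr); tauto |].
      destruct (HD r Hr) as [-> ->]. rewrite Hh2 by auto. rewrite Hkl. field. lra.
Qed.

(** * The coefficient [a] expressed through [h] *)

Lemma amplitude_proportional R1 R2 (a h : R -> R) eps q g r0 :
  0 <= R1 ->
  (forall r, in_interval R1 R2 r -> 0 < a r /\ ex_derive a r) ->
  (forall r, in_interval R1 R2 r -> ex_derive h r) ->
  eps = 1 \/ eps = -1 -> q <> 1 ->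
  in_interval R1 R2 r0 -> h r0 <> 0 ->
  (forall r, in_interval R1 R2 r ->
     g * h r = eps * (r * a r) ^ 2 * signed_power q (h r)) ->
  exists K, forall r, in_interval R1 R2 r -> Rpower (r * a r) (2 / (1 - q)) = K * h r.
Proof.
  intros HR1 Ha Hh Heps Hq Hr0 Hh0 Hg.
  assert (Hpos : forall r, in_interval R1 R2 r -> 0 < r * a r).
  { intros r Hr. apply Rmult_lt_0_compat; [destruct Hr; lra | now apply Ha]. }
  set (G := fun r => Rpower (r * a r) (2 / (1 - q))).
  (* [C] is positive as a value of [Rpower]. Where h <> 0, [Hgr] below writes eps * g as a product
     of positive factors, so [C] is then a genuine power. *)
  set (C := Rpower (eps * g) (1 / (1 - q))).
  assert (HC : 0 < C) by apply exp_pos.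
  assert (HG : forall r, 0 < G r) by (intros; apply exp_pos).
  assert (Habs : forall r, in_interval R1 R2 r -> h r <> 0 -> G r = C * Rabs (h r)).
  { intros r Hr Hhr. specialize (Hpos r Hr).
    assert (Hgr : eps * g = (r * a r) ^ 2 * Rpower (Rabs (h r)) (q - 1)).
    { apply (Rmult_eq_reg_r (h r)); auto. rewrite Rmult_assoc, Hg by auto.
      unfold signed_power. destruct Heps as [-> | ->]; ring. }
    assert (Hap : 0 < Rabs (h r)) by now apply Rabs_pos_lt.
    (* Raising [Hgr] to the power 1 / (1 - q) turns |h|^(q-1) into 1 / |h|. *)
    unfold C, G. rewrite Hgr, <- (Rpower_mult_distr ((r * a r) ^ 2)), Rpower_mult by
      (apply exp_pos || now apply pow_lt).
    replace ((q - 1) * (1 / (1 - q))) with (-(1)) by (field; lra).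
    rewrite Rpower_Ropp, Rpower_1 by auto.
    rewrite <- (Rpower_pow 2), Rpower_mult by auto.
    replace (INR 2 * (1 / (1 - q))) with (2 / (1 - q)) by (simpl; field; lra).
    field. lra. }
  (* By [Habs], [F] is the sign of [h]; being continuous, it is constant. *)
  set (F := fun r => C * h r / G r).
  assert (HF : forall r, in_interval R1 R2 r -> F r = F r0).
  { intros r Hr. apply (discrete_valued_constant R1 R2); auto.
    - clear r Hr. intros r Hr. apply continuity_pt_filterlim.
      apply (ex_derive_continuous F r). unfold F, G, Rpower.
      auto_derive. destruct (Ha r Hr). specialize (Hpos r Hr).
      repeat split; auto. apply Rgt_not_eq, exp_pos.
    - clear r Hr. intros r Hr. unfold F. specialize (HG r).
      destruct (Rtotal_order (h r) 0) as [H | [H | H]].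
      + right; right. rewrite Habs, Rabs_left by (auto; lra). field. lra.
      + left. rewrite H. field. lra.
      + right; left. rewrite Habs, Rabs_pos_eq by (auto; lra). field. lra. }
  (* Solving F = C h / G for G gives this constant; [F] does not vanish because [h r0] does not. *)
  exists (C / F r0). intros r Hr. fold (G r). rewrite <- (HF r Hr).
  assert (HF0 : F r <> 0).
  { rewrite HF by auto. unfold F. apply Rmult_integral_contrapositive_currified.
    - apply Rmult_integral_contrapositive_currified; lra.
    - apply Rinv_neq_0_compat, Rgt_not_eq, HG. }
  assert (Hhr : h r <> 0) by (intros H; apply HF0; unfold F; rewrite H; field;
    apply Rgt_not_eq, HG).
  unfold F. field. repeat split; auto; apply Rgt_not_eq; (apply HC || apply HG).
Qed.

(** * Separation of variables *)

Lemma is_derive_scal_right (f : R -> R) x l c :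
  is_derive f x l -> is_derive (fun s => f s * c) x (l * c).
Proof. exact (is_derive_scal_l f x l c). Qed.

(** The factors inherit their regularity from [u]: freezing the angle at a nonzero value of [w], or
    the radius at [r0], exhibits [h] or [w] as a multiple of a slice of [polar u]. *)
Lemma separation_of_variables R1 R2 a eps q u h w r0 t1 t2 :
  0 <= R1 -> classical_solution R1 R2 a eps q u ->
  (forall r t, in_interval R1 R2 r -> polar u r t = h r * w t) ->
  in_interval R1 R2 r0 -> h r0 <> 0 -> w t1 <> w t2 ->
  continuity w /\
  exists h1 h2 w2 : R -> R,
    (forall r, in_interval R1 R2 r -> is_derive h r (h1 r) /\ is_derive h1 r (h2 r)) /\
    (forall r t, in_interval R1 R2 r ->
       (r ^ 2 * h2 r + r * h1 r) * w t + h r * w2 t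
       = eps * (r * a r) ^ 2 * signed_power q (h r) * signed_power q (w t)).
Proof.
  intros HR1 Hsol Hsep Hr0 Hh0 Hw12.
  assert (Hann : forall r t, in_interval R1 R2 r -> annulus R1 R2 (r * cos t) (r * sin t)).
  { intros r t Hr. unfold annulus. rewrite radius_polar; [auto | destruct Hr; lra]. }
  assert (HC2 : forall r t, in_interval R1 R2 r ->
            locally_2d (ex_diff_n u 2) (r * cos t) (r * sin t)).
  { intros r t Hr. destruct (annulus_locally _ _ _ _ (Hann r t Hr)) as [d Hd].
    exists d. intros x y Hx Hy. now apply Hsol, Hd. }
  assert (HC1 : forall r t, in_interval R1 R2 r ->
            locally_2d (ex_diff_n u 1) (r * cos t) (r * sin t))
    by (intros r t Hr; now apply ex_diff_n_2_dx_dy, HC2).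
  assert (Ht0 : exists t0, w t0 <> 0).
  { destruct (Req_dec (w t1) 0); [exists t2 | exists t1]; congruence. }
  destruct Ht0 as [t0 Ht0].
  assert (Hwu : forall t, polar u r0 t / h r0 = w t)
    by (intros t; rewrite Hsep by auto; field; auto).
  assert (Hhu : forall r, in_interval R1 R2 r -> polar u r t0 / w t0 = h r)
    by (intros r Hr; rewrite Hsep by auto; field; auto).
  assert (Hw : forall t, is_derive w t (polar_t u r0 t / h r0)).
  { intros t. apply (is_derive_ext (fun t => polar u r0 t / h r0)).
    - exact Hwu.
    - apply is_derive_scal_right, is_derive_polar_t. auto. }
  assert (Hw' : forall t, is_derive (fun t => polar_t u r0 t / h r0) t (polar_tt u r0 t / h r0))
    by (intros t; apply is_derive_scal_right, is_derive_polar_tt; auto).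
  (* The factorization holds only for radii in the open interval, so functions of [r] are compared
     locally; functions of the angle are compared everywhere. *)
  assert (Hh : forall r, in_interval R1 R2 r -> is_derive h r (polar_r u r t0 / w t0)).
  { intros r Hr. apply (is_derive_ext_loc (fun r => polar u r t0 / w t0)).
    - generalize (in_interval_locally _ _ _ Hr). apply filter_imp.
      exact Hhu.
    - apply is_derive_scal_right, is_derive_polar_r. auto. }
  assert (Hh' : forall r, in_interval R1 R2 r ->
            is_derive (fun r => polar_r u r t0 / w t0) r (polar_rr u r t0 / w t0))
    by (intros r Hr; apply is_derive_scal_right, is_derive_polar_rr; auto).
  (* From here each polar derivative is computed twice, by the chain rule and from the product form;
     uniqueness of derivatives identifies the results. *)
  assert (Hr : forall r t, in_interval R1 R2 r -> polar_r u r t = polar_r u r t0 / w t0 * w t).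
  { intros r t Hr. rewrite <- (is_derive_unique _ _ _ (is_derive_polar_r u r t (HC1 r t Hr))).
    apply is_derive_unique. apply (is_derive_ext_loc (fun s => h s * w t)).
    - generalize (in_interval_locally _ _ _ Hr). apply filter_imp.
      intros s Hs. now rewrite Hsep.
    - apply is_derive_scal_right. auto. }
  assert (Hrr : forall r t, in_interval R1 R2 r ->
            polar_rr u r t = polar_rr u r t0 / w t0 * w t).
  { intros r t Ir. rewrite <- (is_derive_unique _ _ _ (is_derive_polar_rr u r t (HC2 r t Ir))).
    apply is_derive_unique. apply (is_derive_ext_loc (fun s => polar_r u s t0 / w t0 * w t)).
    - generalize (in_interval_locally _ _ _ Ir). apply filter_imp.
      intros s Hs. now rewrite <- Hr.
    - apply is_derive_scal_right. auto. }
  assert (Ht : forall r t, in_interval R1 R2 r -> polar_t u r t = h r * (polar_t u r0 t / h r0)).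
  { intros r t Ir. rewrite <- (is_derive_unique _ _ _ (is_derive_polar_t u r t (HC1 r t Ir))).
    apply is_derive_unique. apply (is_derive_ext (fun s => h r * w s)).
    - intros s. now rewrite Hsep.
    - apply is_derive_scal. auto. }
  assert (Htt : forall r t, in_interval R1 R2 r ->
            polar_tt u r t = h r * (polar_tt u r0 t / h r0)).
  { intros r t Ir. rewrite <- (is_derive_unique _ _ _ (is_derive_polar_tt u r t (HC2 r t Ir))).
    apply is_derive_unique. apply (is_derive_ext (fun s => h r * (polar_t u r0 s / h r0))).
    - intros s. now rewrite <- Ht.
    - apply is_derive_scal. auto. }
  split.
  { intros t. apply continuity_pt_filterlim, (ex_derive_continuous w t).
    eexists. apply Hw. }
  exists (fun r => polar_r u r t0 / w t0), (fun r => polar_rr u r t0 / w t0),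
    (fun t => polar_tt u r0 t / h r0).
  split; [auto |].
  intros r t Ir. generalize (laplacian_polar u r t).
  rewrite Hr, Hrr, Htt by auto.
  destruct (Hsol _ _ (Hann r t Ir)) as [_ HL].
  rewrite radius_polar in HL by (destruct Ir; lra).
  unfold polar at 1. rewrite HL. fold (polar u r t).
  rewrite Hsep, signed_power_mult by auto. intros H.
  transitivity (r ^ 2 * (eps * a r ^ 2 * (signed_power q (h r) * signed_power q (w t))));
    [rewrite <- H |]; ring.
Qed.

(** * Classification of the coefficient [a] *)

Theorem theorem2 :
  forall (R1 : R) (R2 : Rbar) (a : R -> R) (eps q : R),
    0 <= R1 -> Rbar_lt R1 R2 ->
    (forall r : R, in_interval R1 R2 r -> 0 < a r /\ ex_derive a r) ->
    (eps = 1 \/ eps = -1) ->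
    0 < q -> q <> 1 ->
    (exists u : R -> R -> R,
        classical_solution R1 R2 a eps q u /\
        pseudo_radial R1 R2 u /\
        ~ radial R1 R2 u) ->
    (exists alpha M N : R, 0 < alpha /\
        has_form R1 R2 q a
          (fun r => M * Rpower r alpha + N * Rpower r (- alpha))) \/
    (exists M N : R,
        has_form R1 R2 q a (fun r => M + N * ln r)) \/
    (exists alpha M N : R, 0 < alpha /\
        has_form R1 R2 q a
          (fun r => M * cos (alpha * ln r) + N * sin (alpha * ln r))).
Proof.
  intros R1 R2 a eps q HR1 HR12 Ha Heps Hq0 Hq (u & Hsol & (h & w & _ & Hsep) & Hnr).
  (* Otherwise, at each radius either [h] vanishes or [w] is constant, and [u] is radial. *)
  assert (Hne : exists r0 t1 t2, in_interval R1 R2 r0 /\ h r0 <> 0 /\ w t1 <> w t2).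
  { apply NNPP. intros Hn. apply Hnr. intros r t1 t2 Hr. rewrite !Hsep by auto.
    destruct (Req_dec (h r) 0) as [-> | Hh]; [ring |].
    destruct (Req_dec (w t1) (w t2)) as [-> | Hw]; [ring |].
    exfalso. apply Hn. now exists r, t1, t2. }
  destruct Hne as (r0 & t1 & t2 & Hr0 & Hh0 & Hw12).
  destruct (separation_of_variables R1 R2 a eps q u h w r0 t1 t2)
    as (Hw & h1 & h2 & w2 & Hd & Heq); auto.
  set (A := fun r => r ^ 2 * h2 r + r * h1 r).
  set (C := fun r => eps * (r * a r) ^ 2 * signed_power q (h r)).
  (* The equation at [r0] eliminates [w2]. What remains is a linear relation between [w] and its
     signed power, whose coefficients vanish by independence. *)
  assert (HAC : forall r, in_interval R1 R2 r ->
            A r = A r0 / h r0 * h r /\ C r = C r0 / h r0 * h r).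
  { intros r Hr.
    destruct (signed_power_independent q w t1 t2
                (A r - A r0 / h r0 * h r) (C r - C r0 / h r0 * h r)); auto; [| lra].
    intros t. generalize (Heq r t Hr) (Heq r0 t Hr0).
    fold (A r) (A r0) (C r) (C r0). intros E E0.
    assert (E0' : w2 t = (C r0 * signed_power q (w t) - A r0 * w t) / h r0)
      by (rewrite <- E0; field; auto).
    rewrite E0' in E. rewrite !Rmult_minus_distr_r, <- E. field. auto. }
  destruct (amplitude_proportional R1 R2 a h eps q (C r0 / h r0) r0) as [K HK]; auto.
  { intros r Hr. eexists. now apply Hd. }
  { intros r Hr. symmetry. now apply HAC. }
  (* Raising (r a)^(2/(1-q)) = K h to the power (1 - q) / 2 recovers r a; positivity of [f] is that
     of [Rpower]. *)
  assert (Hform : forall f, (forall r, in_interval R1 R2 r -> K * h r = f r) ->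
            has_form R1 R2 q a f).
  { intros f Hf. split; intros r Hr; rewrite <- Hf, <- HK by auto; [apply exp_pos |].
    assert (0 < r) by (destruct Hr; lra).
    rewrite Rpower_mult. replace (2 / (1 - q) * ((1 - q) / 2)) with 1 by (field; lra).
    rewrite Rpower_1 by (apply Rmult_lt_0_compat; [lra | now apply Ha]).
    field. lra. }
  (* [HAC] for [A] is the Euler equation; in each case [K] is absorbed into the two coefficients. *)
  destruct (euler_equation R1 R2 h h1 h2 (A r0 / h r0) r0)
    as [(k & M & N & Hk & E) | [(M & N & E) | (k & M & N & Hk & E)]]; auto.
  1, 2: intros r Hr; now apply Hd.
  { intros r Hr. now apply HAC. }
  - left. exists k, (K * M), (K * N). split; auto. apply Hform.
    intros r Hr. rewrite E by auto. ring.
  - right; left. exists (K * M), (K * N). apply Hform.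
    intros r Hr. rewrite E by auto. ring.
  - right; right. exists k, (K * M), (K * N). split; auto. apply Hform.
    intros r Hr. rewrite E by auto. ring.
Qed.
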